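(* Let $M$ be a connected, loopless matroid with finite non-empty ground set. Then the arboricity of $M$ equals the maximum size of a cocircuit of $M$ if and only if $M$ is isomorphic to $U_{k,k+1}$ or to $U_{1,k}$ for some integer $k\geq 1$.
   Context: The arboricity $a(M)$ of a loopless matroid $M$ is the minimum number of independent sets into which $E(M)$ can be partitioned. $U_{r,n}$ denotes the uniform matroid of rank $r$ on $n$ elements. *)

(* Defs.v *)
From mathcomp Require Import all_boot.

Set Implicit Arguments.
Unset Strict Implicit.
Unset Printing Implicit Defensive.

(* The ground set of a matroid is the whole finite type T. *)
Record matroid (T : finType) := Matroid {
  indep :> pred {set T};
  indep_set0 : indep set0;
  indep_sub : forall I J : {set T}, J \subset I -> indep I -> indep J;
  indep_aug : forall I J : {set T}, indep I -> indep J -> #|I| < #|J| ->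
    exists2 x, x \in J :\: I & indep (x |: I)
}.

Section MatroidTheory.

Variables (T : finType) (M : matroid T).
Implicit Types (B C I J X Y : {set T}) (x y : T).

Definition basis B := maxset (indep M) B.

Definition circuit C := minset (fun X => ~~ indep M X) C.

Definition loop x := circuit [set x].

Definition loopless := forall x, ~~ loop x.

(* Any two distinct elements lie on a common circuit: E(M) is a single
   component. *)
Definition connected_matroid :=
  forall x y, x != y -> exists C, [/\ circuit C, x \in C & y \in C].

Lemma basis_indep B : basis B -> indep M B.
Proof. by move/maxsetp. Qed.

Lemma indep_le_basis B I : basis B -> indep M I -> #|I| <= #|B|.
Proof.
move=> /maxsetP[iB maxB] iI; rewrite leqNgt; apply/negP => ltBI.
have [x /setDP[_ xNB] ixB] := indep_aug iB iI ltBI.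
by move: xNB; rewrite -(maxB _ ixB (subsetU1 x B)) setU11.
Qed.

(* Extend an independent set I to a basis using elements of a basis B. *)
Lemma basis_extend B I : basis B -> indep M I ->
  exists B', [/\ basis B', I \subset B' & B' \subset I :|: B].
Proof.
move=> bB iI.
pose P X := indep M X && (X \subset I :|: B).
have [|B' /maxsetP[/andP[iB' sB'] maxB'] sIB'] := @maxset_exists _ P I.
  by rewrite /P iI subsetUl.
exists B'; split=> //.
have leBB' : #|B| <= #|B'|.
  rewrite leqNgt; apply/negP => ltB.
  have [x /setDP[xB xNB'] ix] := indep_aug iB' (basis_indep bB) ltB.
  have Px : P (x |: B').
    by rewrite /P ix subUset sB' sub1set inE xB orbT.
  by move: xNB'; rewrite -(maxB' _ Px (subsetU1 x B')) setU11.
apply/maxsetP; split=> // X iX sB'X; apply/esym/eqP.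
by rewrite eqEcard sB'X (leq_trans (indep_le_basis bB iX)).
Qed.

(* The bases of the dual are the complements of the bases of M, so a set is
   independent in the dual iff it is disjoint from some basis of M. *)
Definition coindep X := [exists B, basis B && (X \subset ~: B)].

Lemma coindep_set0 : coindep set0.
Proof.
have [B bB _] := maxset_exists (indep_set0 M).
by apply/existsP; exists B; rewrite [basis B]bB sub0set.
Qed.

Lemma coindep_sub I J : J \subset I -> coindep I -> coindep J.
Proof.
move=> sJI /existsP[B /andP[bB sI]]; apply/existsP; exists B.
by rewrite bB (subset_trans sJI).
Qed.

Lemma coindep_aug I J : coindep I -> coindep J -> #|I| < #|J| ->
  exists2 x, x \in J :\: I & coindep (x |: I).
Proof.
move=> /existsP[BI /andP[bBI dI]] /existsP[BJ /andP[bBJ dJ]] ltIJ.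
have iBJI : indep M (BJ :\: I).
  exact: indep_sub (subsetDl _ _) (basis_indep bBJ).
have [B [bB sB Bs]] := basis_extend bBI iBJI.
have dB : I \subset ~: B.
  apply/subsetP=> x xI; rewrite inE; apply/negP => /(subsetP Bs).
  by rewrite !inE xI /=; have := subsetP dI x xI; rewrite inE => /negP.
have [sJB | /subsetPn[x xJI xNB]] := boolP (J :\: I \subset B); last first.
  exists x => //; apply/existsP; exists B.
  by rewrite bB subUset dB sub1set inE xNB.
have dis : (J :\: I) :&: (BJ :\: I) = set0.
  apply/setP=> x; rewrite !inE.
  apply/negP => /andP[/andP[_ xJ] /andP[_ xBJ]].
  by have := subsetP dJ x xJ; rewrite inE xBJ.
have leU : #|J :\: I| + #|BJ :\: I| <= #|B|.
  rewrite -cardsUI dis cards0 addn0.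
  by apply: subset_leq_card; rewrite subUset sJB sB.
have leBJ := indep_le_basis bBJ (basis_indep bB).
have disJ : #|BJ :&: I| <= #|I :\: J|.
  apply: subset_leq_card; apply/subsetP=> x; rewrite !inE => /andP[xB xI].
  rewrite xI andbT; apply/negP => xJ.
  by have := subsetP dJ x xJ; rewrite inE xB.
have := leq_trans leU leBJ.
rewrite -(cardsID I BJ) leq_add2r => /leq_trans/(_ disJ).
move: ltIJ; rewrite -(cardsID J I) -(cardsID I J) setIC ltn_add2l ltnNge.
by move/negP.
Qed.

Definition dual : matroid T := Matroid coindep_set0 coindep_sub coindep_aug.

(* Only meaningful for a loopless M, when the partition of the ground set into
   singletons is admissible; see arboricityP. *)
Definition indep_partition (P : {set {set T}}) :=
  partition P [set: T] && [forall X in P, indep M X].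

Definition arboricity :=
  #|[arg min_(P < [set [set x] | x : T] | indep_partition P) #|P|]|.

Lemma loopless_indep1 x : loopless -> indep M [set x].
Proof.
move=> /(_ x); apply: contraR => dx; apply/minsetP; split=> // X dX.
by rewrite subset1 => /orP[/eqP // | /eqP X0]; rewrite X0 indep_set0 in dX.
Qed.

Lemma arboricityP : loopless ->
  (exists2 P, indep_partition P & #|P| = arboricity) /\
  (forall P, indep_partition P -> arboricity <= #|P|).
Proof.
move=> ll; rewrite /arboricity; case: arg_minnP => [|P pP minP]; last first.
  by split=> //; exists P.
apply/andP; split; last first.
  by apply/forall_inP=> X /imsetP[x _ ->]; apply: loopless_indep1.
apply/and3P; split.
- apply/eqP/setP=> x; rewrite inE; apply/bigcupP.
  by exists [set x]; rewrite ?imset_f ?set11.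
- apply/trivIsetP=> _ _ /imsetP[x _ ->] /imsetP[y _ ->] nxy.
  by rewrite disjoints1 inE; apply: contra nxy => /eqP->.
- by apply/imsetP=> -[x _ /setP/(_ x)]; rewrite !inE eqxx.
Qed.

End MatroidTheory.

Definition cocircuit (T : finType) (M : matroid T) := circuit (dual M).

Definition max_cocircuit_size (T : finType) (M : matroid T) :=
  \max_(C : {set T} | cocircuit M C) #|C|.

Section Uniform.

Variables r n : nat.

Definition uniform_indep (X : {set 'I_n}) := #|X| <= r.

Lemma uniform_indep_set0 : uniform_indep set0.
Proof. by rewrite /uniform_indep cards0. Qed.

Lemma uniform_indep_sub (I J : {set 'I_n}) :
  J \subset I -> uniform_indep I -> uniform_indep J.
Proof. by move=> /subset_leq_card; apply: leq_trans. Qed.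

Lemma uniform_indep_aug (I J : {set 'I_n}) :
  uniform_indep I -> uniform_indep J -> #|I| < #|J| ->
  exists2 x, x \in J :\: I & uniform_indep (x |: I).
Proof.
move=> _ uJ ltIJ; have /subsetPn[x xJ xNI] : ~~ (J \subset I).
  by apply: contraL ltIJ => /subset_leq_card; rewrite -leqNgt.
exists x; first by rewrite inE xNI.
by rewrite /uniform_indep cardsU1 xNI (leq_trans ltIJ).
Qed.

Definition uniform : matroid 'I_n :=
  Matroid uniform_indep_set0 uniform_indep_sub uniform_indep_aug.

End Uniform.

Definition isomorphic (T T' : finType) (M : matroid T) (M' : matroid T') :=
  exists2 f : T -> T', bijective f & forall X : {set T}, M' (f @: X) = M X.

(* Main.v *)
(* Let the maximum cocircuit size be k+1 and suppose that M is not covered by k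
   independent sets.  By Edmonds' covering theorem some X has more than
   k rank(X) elements; take X minimal.  For a basis B of X, each fundamental
   cocircuit of B in X is contained in a cocircuit of M, so has at most k+1
   elements, and by minimality at least k+1.  If k > 1 they are moreover
   pairwise disjoint, whence rank(X)(k+1) <= |X| = k rank(X) + 1, i.e. X has
   rank 1 and k+1 elements; it is then itself a cocircuit of M.  Since a circuit
   and a cocircuit never meet in one element, connectedness forces X to be the
   whole ground set.  If k = 1, all cocircuits have at most two elements and
   the same orthogonality shows that any circuit is the whole ground set. *)
Require Import Defs.
From mathcomp Require Import all_boot.
From mathcomp Require Import zify.

Set Implicit Arguments.
Unset Strict Implicit.
Unset Printing Implicit Defensive.

Lemma setD1C (T : finType) (A : {set T}) x y : A :\ x :\ y = A :\ y :\ x.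
Proof. by apply/setP=> z; rewrite !inE andbCA. Qed.

(** * Edmonds' covering theorem for a family of rank functions *)

Section Covering.

Variable T : finType.
Implicit Types (A B E X Y : {set T}) (r : {set T} -> nat).

Definition rank_function r :=
  [/\ forall X, r X <= #|X|, {homo r : X Y / X \subset Y >-> X <= Y}
    & forall X Y, r (X :|: Y) + r (X :&: Y) <= r X + r Y].

(** The rank function of the contraction by [x], in the case [r [set x] = 1]. *)
Definition rank_contract r x X := r (x |: X) - 1.

Lemma rank_contract_function r x :
  rank_function r -> r [set x] = 1 -> rank_function (rank_contract r x).
Proof.
move=> [le_r mono_r sub_r] rx.
have r_gt0 X : 0 < r (x |: X) by rewrite -rx mono_r // sub1set setU11.
rewrite /rank_contract; split=> [X | X Y sXY | X Y].
- have := le_r (x |: X); have := cardsU1 x X; case: (x \in X); lia.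
- by rewrite leq_sub2r // mono_r // setUS.
have := sub_r (x |: X) (x |: Y); rewrite -setUUr -setUIr.
have := r_gt0 X; have := r_gt0 Y; have := r_gt0 (X :|: Y).
have := r_gt0 (X :&: Y); lia.
Qed.

(** Submodularity for [x |: X] and [Y], whose union is [x |: Y] and whose intersection contains
    [X]. *)
Lemma rank_spanU1 r x X Y : rank_function r -> X \subset Y ->
  r (x |: X) <= r X -> r (x |: Y) <= r Y.
Proof.
move=> [_ mono_r sub_r] sXY le_x.
have := sub_r (x |: X) Y; rewrite -setUA (setUidPr sXY).
have /mono_r : X \subset (x |: X) :&: Y by rewrite subsetI subsetUr.
lia.
Qed.

(* If no set of the family can absorb e, there is for each i a tight set
   (one attaining equality in the hypothesis) spanning e in r i; tight sets
   are closed under union, and adding e to the union of these violates the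
   hypothesis. *)
Lemma rank_covering (I : finType) (r : I -> {set T} -> nat) E :
    (forall i, rank_function (r i)) ->
    (forall X, X \subset E -> #|X| <= \sum_i r i X) ->
  exists S : I -> {set T},
    (forall i, r i (S i) = #|S i|) /\ (forall x, x \in E -> exists i, x \in S i).
Proof.
have [n] := ubnP #|E|; elim: n => // n IHn in r E *; rewrite ltnS => leEn r_rk leE.
have [->|[e eE]] := set_0Vmem E.
  exists (fun=> set0); split=> [i | x]; last by rewrite inE.
  by case: (r_rk i) => /(_ set0); rewrite cards0 leqn0 => /eqP.
pose E' := E :\ e.
have sE'E : E' \subset E := subsetDl _ _.
have ltE' : #|E'| < n by have := cardsD1 e E; rewrite eE /E'; lia.
(* Putting [e] into the [i]-th set contracts the [i]-th function only, so the induction needs a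
   family even if one starts from equal functions. *)
pose r' i j := if j == i then rank_contract (r i) e else r j.
pose ok i := (r i [set e] == 1)
  && [forall X : {set T}, (X \subset E') ==> (#|X| <= \sum_j r' i j X)].
have sumr' i X : \sum_j r' i j X + r i X = \sum_j r j X + rank_contract (r i) e X.
  rewrite (bigD1 i) //= [in RHS](bigD1 i) //= /r' eqxx.
  under eq_bigr => j /negPf-> do [].
  lia.
have [i /andP[/eqP rie /forallP oki] | nok] := pickP ok.
  have [||S [rS coverS]] := IHn (r' i) E' ltE'.
  - by move=> j; rewrite /r'; case: eqP => // _; apply: rank_contract_function.
  - by move=> X sX; have /implyP := oki X; apply.
  exists (fun j => if j == i then e |: S i else S j); split=> [j|x xE].
    have := rS j; rewrite /r'; case: eqVneq => [-> | //]; rewrite /rank_contract.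
    have [le_r mono_r _] := r_rk i.
    have := le_r (e |: S i); have := cardsU1 e (S i).
    have : r i [set e] <= r i (e |: S i) by rewrite mono_r // sub1set setU11.
    (* [S i] is not known to lie in [E']; if it contained [e], its contracted rank would be less
       than its size. *)
    have [eSi | _] := boolP (e \in S i); last by lia.
    by rewrite (setUidPr _) ?sub1set //; lia.
  have [-> | xe] := eqVneq x e; first by exists i; rewrite eqxx setU11.
  have [|j xj] := coverS x; first by rewrite !inE xe.
  by exists j; case: eqVneq xj => // -> xi; rewrite setU1r.
have bad i : {X : {set T} | [&& X \subset E', \sum_j r j X <= #|X|
                             & r i (e |: X) <= r i X]}.
  apply: sigW; have [le_r mono_r _] := r_rk i.
  have := nok i; rewrite /ok; have [rie /= | rie _] := eqVneq.
    move=> /negbT; rewrite negb_forall => /existsP[X].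
    rewrite negb_imply -ltnNge => /andP[sX ltX]; exists X; rewrite sX /=.
    (* Contraction lowers the sum by at most one, so a set violating the inequality afterwards was
       tight before and spans [e]. *)
    have := leE X (subset_trans sX sE'E).
    have := sumr' i X; rewrite /rank_contract.
    have : r i X <= r i (e |: X) by rewrite mono_r ?subsetUr.
    have : r i [set e] <= r i (e |: X) by rewrite mono_r // sub1set setU11.
    lia.
  (* Here [e] has rank 0 in [r i], so the empty set is tight and spans it. *)
  exists set0; rewrite sub0set cards0 setU0 leqn0 sum_nat_eq0 /=.
  apply/andP; split.
    by apply/forallP=> j; have [/(_ set0)] := r_rk j; rewrite cards0 leqn0.
  by have := le_r [set e]; rewrite cards1; lia.
pose U := \bigcup_i sval (bad i).
have [sU tightU] : U \subset E' /\ \sum_j r j U <= #|U|.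
  rewrite /U; elim/big_rec: _ => [|i X _ [sX tX]].
    split; rewrite ?sub0set // cards0 leqn0 sum_nat_eq0.
    by apply/forallP=> j; have [/(_ set0)] := r_rk j; rewrite cards0 leqn0.
  case: (bad i) => Y /= /and3P[sY tY _].
  have sI : Y :&: X \subset E.
    by rewrite (subset_trans (subsetIl _ _)) ?(subset_trans sY).
  rewrite subUset sY sX; split=> //.
  have := leE _ sI; have := cardsUI Y X.
  have : \sum_j r j (Y :|: X) + \sum_j r j (Y :&: X) <= \sum_j r j Y + \sum_j r j X.
    by rewrite -!big_split /=; apply: leq_sum => j _; have [_ _ ->] := r_rk j.
  lia.
have eU : e \notin U by apply: contraTN isT => /(subsetP sU); rewrite !inE eqxx.
have := leE (e |: U); rewrite cardsU1 eU subUset sub1set eE (subset_trans sU sE'E).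
move=> /(_ isT); suff : \sum_j r j (e |: U) <= \sum_j r j U by lia.
apply: leq_sum => j _; apply: (@rank_spanU1 _ _ (sval (bad j))) => //.
  by rewrite /U (bigcup_sup j).
by case: (bad j) => X /= /and3P[].
Qed.

End Covering.

(** * Rank and bases of subsets *)

Section Rank.

Variables (T : finType) (M : matroid T).
Implicit Types (B C I J X Y : {set T}) (x y b : T).

Definition rank X := \max_(I : {set T} | indep M I && (I \subset X)) #|I|.

Lemma leq_rank I X : indep M I -> I \subset X -> #|I| <= rank X.
Proof. by move=> iI sIX; apply: leq_bigmax_cond; rewrite iI. Qed.

Definition basis_of X B := [/\ indep M B, B \subset X & #|B| = rank X].

Lemma basis_of_extend I X : indep M I -> I \subset X ->
  exists2 B, basis_of X B & I \subset B.
Proof.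
move=> iI sIX; pose P J := indep M J && (J \subset X).
have [|B /maxsetP[/andP[iB sBX] maxB] sIB] := @maxset_exists _ P I.
  by rewrite /P iI.
exists B => //; split=> //; apply/eqP; rewrite eqn_leq leq_rank //=.
apply/bigmax_leqP=> J /andP[iJ sJX]; rewrite leqNgt; apply/negP=> ltBJ.
have [x /setDP[xJ xNB] ix] := indep_aug iB iJ ltBJ.
case/negP: xNB; rewrite -(maxB (x |: B)) ?setU11 ?subsetUr //.
by rewrite /P ix subUset sub1set (subsetP sJX).
Qed.

Lemma basis_of_exists X : exists B, basis_of X B.
Proof.
by have [B bB _] := basis_of_extend (indep_set0 M) (sub0set X); exists B.
Qed.

Lemma rank_indepE X : indep M X = (rank X == #|X|).
Proof.
apply/idP/eqP => [iX | rX].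
  apply/eqP; rewrite eqn_leq leq_rank // andbT.
  by apply/bigmax_leqP=> J /andP[_ /subset_leq_card].
have [B [iB sBX cB]] := basis_of_exists X.
by have /eqP <- : B == X by rewrite eqEcard sBX cB rX leqnn.
Qed.

Lemma rank_rank_function : rank_function rank.
Proof.
split=> [X | X Y sXY | X Y].
- by apply/bigmax_leqP=> J /andP[_ /subset_leq_card].
- by apply/bigmax_leqP=> J /andP[iJ sJ]; rewrite leq_rank // (subset_trans sJ).
have [I [iI sI <-]] := basis_of_exists (X :&: Y).
have [|B [iB sB <-] sIB] := @basis_of_extend I (X :|: Y) iI.
  by apply: subset_trans sI _; rewrite subIset // subsetUl.
have iBX : indep M (B :&: X) := indep_sub (subsetIl _ _) iB.
have iBY : indep M (B :&: Y) := indep_sub (subsetIl _ _) iB.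
have := leq_rank iBX (subsetIr _ _); have := leq_rank iBY (subsetIr _ _).
have := cardsUI (B :&: X) (B :&: Y); rewrite -setIUr -setIIr (setIidPl sB).
have : #|I| <= #|B :&: (X :&: Y)| by rewrite subset_leq_card // subsetI sIB.
lia.
Qed.

Lemma basisP B : reflect (basis_of setT B) (basis M B).
Proof.
apply: (iffP idP) => [bB | [iB _ cB]].
  split; rewrite ?subsetT ?basis_indep //; apply/eqP.
  rewrite eqn_leq leq_rank ?basis_indep ?subsetT //.
  by apply/bigmax_leqP=> J /andP[iJ _]; rewrite (indep_le_basis bB).
apply/maxsetP; split=> // J iJ sBJ; apply/esym/eqP.
by rewrite eqEcard sBJ cB leq_rank ?subsetT.
Qed.

(** * Circuits and cocircuits *)

Lemma circuitP C : reflect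
  (~~ indep M C /\ forall x, x \in C -> indep M (C :\ x)) (circuit M C).
Proof.
apply: (iffP minsetP) => -[dC minC]; split=> //.
  move=> x xC; apply: contraT => dCx.
  by have /setP/(_ x) := minC _ dCx (subsetDl _ _); rewrite !inE eqxx xC.
move=> X dX sXC; apply/eqP; rewrite eqEsubset sXC; apply/subsetP=> x xC.
apply: contraR dX => xNX; apply: indep_sub (minC x xC).
by rewrite subsetD1 sXC.
Qed.

Lemma circuit_sub_eq C X : circuit M C -> X \subset C -> ~~ indep M X -> X = C.
Proof. by case/minsetP=> _ minC sXC dX; apply: minC. Qed.

(** A basis avoiding [D :\ x] extends [C :\ x] to a basis [B']. It omits [x], or it would contain
    [C]; hence it avoids all of [D], against the dependence of [D] in the dual. *)
Lemma orthogonality C D x : circuit M C -> cocircuit M D -> C :&: D = [set x] ->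
  False.
Proof.
move=> /circuitP[dC minC] /minsetP[dD minD] CDx.
have /setIP[xC xD] : x \in C :&: D by rewrite CDx set11.
have CD y : y \in C -> y \in D -> y = x.
  by move=> yC yD; apply/set1P; rewrite -CDx inE yC.
have /existsP[B /andP[bB sDB]] : coindep M (D :\ x).
  apply: contraT => /minD/(_ (subsetDl _ _))/setP/(_ x).
  by rewrite !inE eqxx xD.
have [B' [bB' sCB' sB']] := basis_extend bB (minC x xC).
case/negP: dD; apply/existsP; exists B'; rewrite bB'; apply/subsetP=> y yD.
rewrite inE; apply/negP => yB'.
have [yx | yx] := eqVneq y x.
  case/negP: dC; apply: indep_sub (basis_indep bB').
  by rewrite -(setD1K xC) subUset sub1set -yx yB' yx.
have /setUP[/setD1P[_ yC] | yB] := subsetP sB' y yB'.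
  by rewrite (CD y) ?eqxx in yx.
by have := subsetP sDB y; rewrite !inE yx yD yB => /(_ isT).
Qed.

(** * Fundamental cocircuits of a restriction *)

(** For a basis [B] of [X] and [b] in [B], this is the complement in [X] of the hyperplane spanned
    by [B :\ b]. *)
Definition fund_cocircuit X B b := [set x in X | rank (x |: (B :\ b)) == rank X].

Lemma fund_cocircuitP X B b x : basis_of X B -> b \in B ->
  reflect [/\ x \in X, x \notin B :\ b & indep M (x |: (B :\ b))]
          (x \in fund_cocircuit X B b).
Proof.
move=> [iB sBX cB] bB; rewrite [in X in reflect _ X]inE rank_indepE cardsU1.
have := cardsD1 b B; rewrite bB cB => ->.
have [le_r _ _] := rank_rank_function.
have := le_r (x |: B :\ b); rewrite cardsU1 => le1.
apply: (iffP andP) => -[]; case: (x \in B :\ b) le1 => /=; first by lia.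
all: by move=> *; split=> //; lia.
Qed.

Lemma basis_mem_fund_cocircuit X B b : basis_of X B -> b \in B ->
  b \in fund_cocircuit X B b.
Proof.
by move=> bas bB; apply/fund_cocircuitP=> //; rewrite setD11 setD1K //;
  case: bas => iB sB _; rewrite (subsetP sB).
Qed.

Lemma basis_of_exchange X B b x : basis_of X B -> b \in B ->
  x \in fund_cocircuit X B b -> basis_of X (x |: (B :\ b)).
Proof.
move=> bas bB /fund_cocircuitP[] // xX xNB ix; have [iB sBX cB] := bas.
split=> //; last by have := cardsD1 b B; rewrite cardsU1 xNB bB cB; lia.
by rewrite subUset sub1set xX (subset_trans (subsetDl _ _)).
Qed.

(** A basis avoiding the set would augment [B :\ b] by one of its elements. A subset missing [x]
    avoids the basis [x |: (B :\ b)]. *)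
Lemma fund_cocircuit_cocircuit B b : basis M B -> b \in B ->
  cocircuit M (fund_cocircuit setT B b).
Proof.
move=> /basisP bas bB; have [iB _ cB] := bas; have := cardsD1 b B; rewrite bB => cBb.
apply/minsetP; split=> [|Y dY sY].
  apply/existsP=> -[B0 /andP[/basisP[iB0 _ cB0]]] /subsetP sB0.
  have [||x /setDP[xB0 xNB] ix] := @indep_aug _ M (B :\ b) B0 _ iB0; try lia.
    exact: indep_sub (subsetDl _ _) iB.
  have /sB0 : x \in fund_cocircuit setT B b by apply/fund_cocircuitP.
  by rewrite in_setC xB0.
apply/eqP; rewrite eqEsubset sY; apply/subsetP=> x xC.
apply: contraR dY => xNY; apply/existsP; exists (x |: (B :\ b)).
apply/andP; split; first by apply/basisP; apply: basis_of_exchange.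
apply/subsetP=> y yY; have /fund_cocircuitP[] // := subsetP sY y yY.
move=> _ yNB _; rewrite inE in_setU1 negb_or yNB andbT.
by apply: contraNneq xNY => <-.
Qed.

(** Extend [x |: (B :\ b)] to a basis inside [x |: B']. It omits [b], since [x |: B] is too large to
    be independent in [X]; by size it is [x |: (B' :\ b)]. Thus cocircuit sizes in [X] are bounded
    by those in the matroid. *)
Lemma fund_cocircuit_sub X B b B' : basis_of X B -> b \in B -> basis M B' ->
  B \subset B' -> fund_cocircuit X B b \subset fund_cocircuit setT B' b.
Proof.
move=> bas bB bB' sBB'; have [iB sBX cB] := bas.
have bB'b := subsetP sBB' b bB.
apply/subsetP=> x xC; have [-> | xb] := eqVneq x b.
  by apply: basis_mem_fund_cocircuit => //; apply/basisP.
have [xX xNB ix] := fund_cocircuitP x bas bB xC.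
have [B2 [bB2 sB2 B2s]] := basis_extend bB' ix.
have bNB2 : b \notin B2.
  apply/negP => bB2'; have : x |: B \subset B2.
    by rewrite -(setD1K bB) setUCA subUset sub1set bB2'.
  move=> /indep_sub/(_ (basis_indep bB2))/(@leq_rank _ X).
  rewrite subUset sub1set xX sBX => /(_ isT); rewrite -cB cardsU1.
  by move: xNB; rewrite !inE xb /= => ->; rewrite add1n ltnn.
have sB2x : B2 \subset x |: (B' :\ b).
  apply/subsetP=> y yB2; have yb : y != b by apply: contraNneq bNB2 => <-.
  have := subsetP B2s y yB2; rewrite !inE yb /= -orbA.
  by case/or3P=> [-> // | /(subsetP sBB') -> | ->]; rewrite orbT.
have [/basisP[_ _ cB2] /basisP[_ _ cB']] := (bB2, bB').
have := cardsD1 b B'; have := cardsU1 x (B' :\ b); rewrite bB'b cB' -cB2 => c1 c2.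
have xNB' : x \notin B' :\ b.
  have := subset_leq_card sB2x; rewrite c1 c2 leq_add2r.
  by case: (x \in B' :\ b).
apply/fund_cocircuitP; [exact/basisP | by [] | split; rewrite ?in_setT //].
have /eqP <- : B2 == x |: (B' :\ b) by rewrite eqEcard sB2x c1 c2 xNB' leqnn.
exact: basis_indep.
Qed.

Lemma cocircuit_le_max C : cocircuit M C -> #|C| <= max_cocircuit_size M.
Proof. by move=> cC; apply: leq_bigmax_cond. Qed.

Lemma fund_cocircuit_le_max X B b : basis_of X B -> b \in B ->
  #|fund_cocircuit X B b| <= max_cocircuit_size M.
Proof.
move=> bas bB; have [iB sBX _] := bas.
have [B' /basisP bB' sBB'] := basis_of_extend iB (subsetT B).
apply: leq_trans (subset_leq_card (fund_cocircuit_sub bas bB bB' sBB')) _.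
by apply/cocircuit_le_max/fund_cocircuit_cocircuit => //; apply: (subsetP sBB').
Qed.

Lemma rank_setD_fund_cocircuit X B b : basis_of X B -> b \in B ->
  rank (X :\: fund_cocircuit X B b) < rank X.
Proof.
move=> bas bB; have [iB sBX cB] := bas; have := cardsD1 b B; rewrite bB => cBb.
rewrite ltnNge; apply/negP => leX.
have [J [iJ sJ cJ]] := basis_of_exists (X :\: fund_cocircuit X B b).
have [||x /setDP[xJ xNB] ix] := @indep_aug _ M (B :\ b) J _ iJ; try lia.
  exact: indep_sub (subsetDl _ _) iB.
have /setDP[xX /negP[]] := subsetP sJ x xJ.
exact/fund_cocircuitP.
Qed.

(** Otherwise some [x] outside both cocircuits augments [B :\ b :\ c]. Augmenting once more from [B]
    adds [c] or [b], which puts [x] in the cocircuit of [b] or of [c]. *)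
Lemma rank_setD2_fund_cocircuit X B b c : basis_of X B ->
  b \in B -> c \in B -> b != c ->
  (rank (X :\: (fund_cocircuit X B b :|: fund_cocircuit X B c))).+1 < rank X.
Proof.
move=> bas bB cB' bc; have [iB sBX cB] := bas.
have := cardsD1 b B; have := cardsD1 c (B :\ b).
rewrite bB !inE eq_sym bc cB' /= => c1 c2.
rewrite ltnNge; apply/negP => leX.
have [J [iJ sJ cJ]] :=
  basis_of_exists (X :\: (fund_cocircuit X B b :|: fund_cocircuit X B c)).
have [||x /setDP[xJ xNB] ix] := @indep_aug _ M (B :\ b :\ c) J _ iJ.
- by apply: indep_sub iB; rewrite (subset_trans (subsetDl _ _)) ?subsetDl.
- by clear -c1 c2 cB cJ leX; lia.
have := subsetP sJ x xJ; rewrite inE in_setU negb_or => /andP[/andP[xCb xCc] xX].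
have [|y /setDP[yB yN] iy] := indep_aug ix iB.
  by rewrite cardsU1 xNB; clear -c1 c2 cB; lia.
move: yN; rewrite !inE yB andbT negb_or negb_and !negbK => /andP[yx /orP[/eqP yc | /eqP yb]].
  case/negP: xCb; apply/fund_cocircuitP=> //; split=> //.
    by move: xNB; rewrite !inE -yc eq_sym yx.
  by rewrite yc setUCA setD1K // !inE eq_sym bc in iy.
case/negP: xCc; apply/fund_cocircuitP=> //; split=> //.
  by move: xNB; rewrite !inE -yb [x == y]eq_sym yx.
by rewrite yb setUCA setD1C setD1K // !inE bc in iy.
Qed.

(** Augmenting [x |: (B :\ b :\ c)] from the basis [e |: (B :\ c)] cannot add [b], as [x] is outside
    the cocircuit of [c]; so it adds [e]. This places [x] in the cocircuit of [c] after [b] is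
    exchanged for [e]. *)
Lemma fund_cocircuit_setD X B b c e x : basis_of X B ->
  b \in B -> c \in B -> b != c -> e \in fund_cocircuit X B c ->
  x \in fund_cocircuit X B b -> x \notin fund_cocircuit X B c ->
  indep M (x |: (e |: (B :\ b :\ c))) /\ x \notin e |: (B :\ b :\ c).
Proof.
move=> bas bB cB' bc eC xCb xNCc; have [iB sBX cB] := bas.
have c2 := cardsD1 b B; have c1 := cardsD1 c (B :\ b).
rewrite bB in c2; rewrite !inE eq_sym bc cB' /= in c1.
have [xX xNB ix] := fund_cocircuitP x bas bB xCb.
have [eX eNB ie] := fund_cocircuitP e bas cB' eC.
have [_ _ ce] := basis_of_exchange bas cB' eC.
have xF : x \notin B :\ b :\ c by apply: contra xNB; rewrite !inE => /andP[].
have iF : indep M (x |: (B :\ b :\ c)).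
  by apply: indep_sub ix; rewrite setUS // subsetDl.
have [|y /setDP[ye yN] iy] := indep_aug iF ie.
  by rewrite ce cardsU1 xF; clear -c1 c2 cB; lia.
have xe : x != e by apply: contraNneq xNCc => ->.
have Bcb : b |: (B :\ b :\ c) = B :\ c.
  by rewrite setD1C setD1K // !inE bc.
split; last by rewrite in_setU1 (negPf xe).
have [yb | yb] := eqVneq y b.
  case/negP: xNCc; apply/fund_cocircuitP=> //; split=> //; last first.
    by rewrite yb setUCA Bcb in iy.
  rewrite -Bcb in_setU1 negb_or xF andbT -yb; apply: contra yN => /eqP->.
  exact: setU11.
suff <- : y = e by rewrite setUCA.
move: ye yN; rewrite -Bcb !inE (negPf yb) /= => /orP[/eqP // | ->].
by rewrite orbT.
Qed.

(** * Minimal sets with more than [k] times their rank in elements *)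

(** The drop in rank makes [X :\: D] a proper subset, so it has at most [k * (rank X - t)]
    elements. *)
Lemma minimal_dense_card k t X D :
    k * rank X < #|X| -> (forall Y, Y \proper X -> #|Y| <= k * rank Y) ->
    rank (X :\: D) + t <= rank X -> 0 < t ->
  k * t < #|X :&: D|.
Proof.
move=> ltX minX le_r t_gt0; have := cardsID D X.
have /minX : X :\: D \proper X.
  rewrite properEneq subsetDl andbT; apply: contraTneq le_r => ->; lia.
by have := leq_mul (leqnn k) le_r; rewrite mulnDr; lia.
Qed.

(* By minimality of X the two cocircuits and their union have at least k+1,
   k+1 and 2k+1 elements, so the cocircuits meet in at most one element e.
   Exchanging b for e in B gives a third cocircuit containing the at least 2k
   other elements of the union. *)
Lemma fund_cocircuit_disjoint k X B b c :
    max_cocircuit_size M = k.+1 -> 1 < k ->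
    k * rank X < #|X| -> (forall Y, Y \proper X -> #|Y| <= k * rank Y) ->
    basis_of X B -> b \in B -> c \in B -> b != c ->
  [disjoint fund_cocircuit X B b & fund_cocircuit X B c].
Proof.
move=> maxM k_gt1 ltX minX bas bB cB bc.
set Cb := fund_cocircuit X B b; set Cc := fund_cocircuit X B c.
have sCX a : fund_cocircuit X B a \subset X.
  by apply/subsetP=> x; rewrite inE => /andP[].
have geC a : a \in B -> k < #|fund_cocircuit X B a|.
  move=> aB; have := rank_setD_fund_cocircuit bas aB; rewrite -addn1.
  move/(minimal_dense_card ltX minX)=> /(_ isT).
  by rewrite (setIidPr (sCX a)) muln1.
have geU : k * 2 < #|Cb :|: Cc|.
  have := rank_setD2_fund_cocircuit bas bB cB bc; rewrite -addn2.
  move/(minimal_dense_card ltX minX)=> /(_ isT).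
  by rewrite (setIidPr _) // subUset !sCX.
have leC a : a \in B -> #|fund_cocircuit X B a| <= k.+1.
  by move=> aB; rewrite -maxM fund_cocircuit_le_max.
rewrite -setI_eq0; apply/set0Pn=> -[e /setIP[eCb eCc]].
have basB' := basis_of_exchange bas bB eCb.
set B' := e |: B :\ b in basB'.
have [eX eNBb _] := fund_cocircuitP e bas bB eCb.
have cB' : c \in B' by rewrite !inE [c == b]eq_sym bc cB orbT.
have ec : e != c by apply: contraNneq eNBb => ->; rewrite !inE [c == b]eq_sym bc cB.
have B'c : B' :\ c = e |: (B :\ b :\ c).
  apply/setP=> x; rewrite !inE; have [-> | //] := eqVneq x e.
  by rewrite ec.
have sD : (Cb :|: Cc) :\: (Cb :&: Cc) \subset fund_cocircuit X B' c.
  apply/subsetP=> x; rewrite in_setD in_setI in_setU negb_and.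
  case/andP=> nx xU; have xX : x \in X.
    by case/orP: xU; apply: (subsetP (sCX _)).
  apply/fund_cocircuitP=> //; rewrite B'c.
  case/orP: nx => xN; rewrite (negPf xN) /= ?orbF in xU; last first.
    by have [] := fund_cocircuit_setD bas bB cB bc eCc xU xN.
  have [] := fund_cocircuit_setD bas cB bB _ eCb xU xN; first by rewrite eq_sym.
  by rewrite setD1C.
(* The count gives [2k <= k + 1], impossible for [k > 1]. *)
have := fund_cocircuit_le_max basB' cB'; rewrite maxM.
have := subset_leq_card sD; have := cardsUI Cb Cc.
have := cardsID (Cb :&: Cc) (Cb :|: Cc).
rewrite (setIidPr _) ?(subset_trans (subsetIl _ _)) ?subsetUl //.
have := geC b bB; have := geC c cB; have := leC b bB; have := leC c cB.
rewrite -/Cb -/Cc; move: geU; clear -k_gt1; lia.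
Qed.

Lemma minimal_dense_rank1 k X : loopless M ->
    max_cocircuit_size M = k.+1 -> 1 < k ->
    k * rank X < #|X| -> (forall Y, Y \proper X -> #|Y| <= k * rank Y) ->
  rank X = 1 /\ #|X| = k.+1.
Proof.
move=> ll maxM k_gt1 ltX minX.
have [x xX] : exists x, x \in X by apply/card_gt0P; lia.
have r_gt0 : 0 < rank X.
  by rewrite -(cards1 x) leq_rank ?loopless_indep1 // sub1set.
have cX : #|X| <= (k * rank X).+1.
  have := cardsD1 x X; rewrite xX; have /minX := properD1 xX.
  have [_ mono_r _] := rank_rank_function.
  have := leq_mul (leqnn k) (mono_r _ _ (subsetDl X [set x])); lia.
(* With [cX] this bound reads [rank X * (k + 1) <= k * rank X + 1], so the rank is at most 1. *)
suff : rank X * k.+1 <= #|X| by move: r_gt0 cX ltX; case: (rank X) => [//|[|n]]; nia.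
have [B bas] := basis_of_exists X; have [_ _ <-] := bas.
have geC b : b \in B -> k.+1 <= #|fund_cocircuit X B b|.
  move=> bB; have := rank_setD_fund_cocircuit bas bB; rewrite -addn1.
  move/(minimal_dense_card ltX minX)=> /(_ isT); rewrite muln1.
  by move/leq_trans; apply; apply/subset_leq_card/subsetIr.
pose F b := if b \in B then fund_cocircuit X B b else set0.
have disF b c : b != c -> [disjoint F b & F c].
  rewrite /F => bc; case: ifP => [bB|_]; last by rewrite -setI_eq0 set0I.
  case: ifP => [cB|_]; last by rewrite -setI_eq0 setI0.
  exact: (@fund_cocircuit_disjoint k).
have sFX : \bigcup_b F b \subset X.
  apply/bigcupsP=> b _; rewrite /F; case: ifP => _; last exact: sub0set.
  by apply/subsetP=> y; rewrite inE => /andP[].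
apply: leq_trans (subset_leq_card sFX).
rewrite -sum_nat_const big_mkcond -sum1_card partition_disjoint_bigcup //=.
by apply: leq_sum => b _; rewrite sum1_card /F; case: ifP => // /geC.
Qed.


(** * Consequences of connectedness *)

(** A circuit through [x] in [X] and [y] outside meets [X] in [x] alone: with another common element
    [z], the dependent pair [[set z; x]] would be the whole circuit. *)
Lemma cocircuit_rank1_full X : connected_matroid M -> cocircuit M X ->
  rank X <= 1 -> X = setT.
Proof.
move=> conn cX rX; have [X0 | [x xX]] := set_0Vmem X.
  by have [] := minsetP cX; rewrite X0 indep_set0.
apply/eqP; rewrite -subTset; apply/subsetP=> y _.
have [-> // | yx] := eqVneq y x.
have [C [cC yC xC]] := conn y x yx.
apply: contraT => yNX; case: (orthogonality cC cX (x := x)).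
apply/eqP; rewrite eqEsubset sub1set in_setI xC xX !andbT.
apply/subsetP=> z /setIP[zC zX]; rewrite inE; apply: contraNT yNX => zx.
have Cxz : [set z; x] = C.
  apply: circuit_sub_eq => //; first by rewrite subUset !sub1set zC.
  apply/negP=> /(@leq_rank _ X); rewrite cards2 zx subUset !sub1set zX xX.
  by move=> /(_ isT); rewrite leqNgt ltnS rX.
by move: yC; rewrite -Cxz !inE => /orP[] /eqP->.
Qed.

(** Given [y] outside [D], take a circuit [C] through [y] and some [e] in [D], and [b] in [D] but
    not in [C]. For a basis containing [D :\ e], the cocircuit of [b] must contain [e] by
    orthogonality with [D]. Having at most two elements, it meets [C] in [e] alone. *)
Lemma circuit_full D : connected_matroid M -> max_cocircuit_size M <= 2 ->
  circuit M D -> D = setT.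
Proof.
move=> conn le2 cD; have [dD minD] := circuitP _ cD.
have [D0 | [e eD]] := set_0Vmem D; first by rewrite D0 indep_set0 in dD.
apply/eqP; rewrite -subTset; apply/subsetP=> y _; apply: contraT => yND.
have [|C [cC eC yC]] := conn e y; first by apply: contraNneq yND => <-.
have [b bD bNC] : exists2 b, b \in D & b \notin C.
  apply/subsetPn; apply: contra yND => sDC.
  by rewrite (circuit_sub_eq cC sDC dD).
have be : b != e by apply: contraNneq bNC => ->.
have [B basB sDB] := basis_of_extend (minD e eD) (subsetT _).
have bB : b \in B by apply: (subsetP sDB); rewrite !inE be.
have bB' : basis M B by apply/basisP.
have cF := fund_cocircuit_cocircuit bB' bB.
have bF := basis_mem_fund_cocircuit basB bB.
set F := fund_cocircuit setT B b in cF bF.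
have eF : e \in F.
  apply: contraT => eNF; case: (orthogonality cD cF (x := b)).
  apply/eqP; rewrite eqEsubset sub1set in_setI bD bF !andbT.
  apply/subsetP=> z /setIP[zD zF]; rewrite inE; apply: contraT => zb.
  have [_ + _] := fund_cocircuitP z basB bB zF.
  rewrite !inE zb (subsetP sDB) // !inE zD andbT.
  by apply: contraNneq eNF => <-.
have FE : F = [set e; b].
  apply/esym/eqP; rewrite eqEcard subUset !sub1set eF bF cards2 eq_sym be.
  exact: leq_trans (cocircuit_le_max cF) le2.
case: (orthogonality cC cF (x := e)); apply/eqP.
rewrite FE eqEsubset sub1set !inE eC eqxx !andbT.
apply/subsetP=> z; rewrite !inE => /andP[zC /orP[// | /eqP zb]].
by rewrite -zb zC in bNC.
Qed.

(** * Arboricity and coverings *)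

(** Choosing for each element one set containing it turns a covering with overlaps into a partition;
    its blocks are the non-empty fibres of the choice. *)
Lemma arboricity_le_cover (I : finType) (S : I -> {set T}) : loopless M ->
    (forall i, indep M (S i)) -> (forall x, exists i, x \in S i) ->
  arboricity M <= #|I|.
Proof.
move=> ll iS coverS.
have ex x : {i | x \in S i} by apply: sigW.
pose g x := sval (ex x).
have sgS i : [set x | g x == i] \subset S i.
  by apply/subsetP=> x; rewrite inE /g; case: (ex x) => j xj /= /eqP <-.
have PE X : X \in preim_partition g setT -> X \in [set [set x | g x == i] | i : I].
  case/imsetP=> x _ ->; apply/imsetP; exists (g x) => //.
  by apply/setP=> y; rewrite !inE eq_sym.
have [_ /(_ (preim_partition g setT)) leP] := arboricityP ll.
apply: leq_trans (leP _) _.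
  rewrite /indep_partition preim_partitionP /=; apply/forall_inP=> X /PE.
  by case/imsetP=> i _ ->; apply: indep_sub (sgS i) (iS i).
apply: leq_trans (leq_imset_card (fun i => [set x | g x == i]) predT).
by apply/subset_leq_card/subsetP=> X /PE.
Qed.

Lemma card_le_arboricity r : loopless M ->
  (forall X, indep M X -> #|X| <= r) -> #|T| <= arboricity M * r.
Proof.
move=> ll le_r; have [[P /andP[partP /forall_inP iP] <-] _] := arboricityP ll.
rewrite -cardsT (card_partition partP) -sum_nat_const.
by apply: leq_sum => X /iP/le_r.
Qed.

(** If no set were dense, the covering theorem for [k] copies of [rank] would cover the ground set
    by [k] independent sets. *)
Lemma minimal_dense_exists k : loopless M -> k < arboricity M ->
  exists2 X, k * rank X < #|X| & forall Y, Y \proper X -> #|Y| <= k * rank Y.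
Proof.
move=> ll lt_k; pose P X := k * rank X < #|X|.
have /existsP/ex_minset[X /minsetP[PX minX]] : [exists X, P X].
  apply: contraLR lt_k; rewrite negb_exists -leqNgt => /forallP nP.
  have [|X _|S [rS coverS]] := @rank_covering T 'I_k (fun=> rank) setT.
  - by move=> _; apply: rank_rank_function.
  - by rewrite sum_nat_const card_ord leqNgt nP.
  rewrite -[k]card_ord; apply: (@arboricity_le_cover _ S) => // [i | x].
    by rewrite rank_indepE rS.
  exact: coverS.
exists X => // Y ltY; rewrite leqNgt; apply: contraL ltY => PY.
by rewrite properE negb_and negbK; case: (boolP (Y \subset X)) => // /(minX Y PY) ->; rewrite subxx.
Qed.

(** Singletons are independent, so [X] is the fundamental cocircuit of any of its points inside [X],
    hence lies in a cocircuit of the matroid. The size bound makes them equal. *)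
Lemma rank1_max_full X : loopless M -> connected_matroid M ->
  rank X = 1 -> max_cocircuit_size M <= #|X| -> X = setT.
Proof.
move=> ll conn rX maxX.
have [b bX] : exists b, b \in X.
  by apply/card_gt0P; have [le_r _ _] := rank_rank_function; rewrite -rX.
have bas : basis_of X [set b].
  by split; [apply: loopless_indep1 | rewrite sub1set | rewrite cards1].
have [iB sB _] := bas; have [B' basB' sB'] := basis_of_extend iB (subsetT _).
have bB' : basis M B' by apply/basisP.
have bb : b \in [set b] := set11 b.
have cF := fund_cocircuit_cocircuit bB' (subsetP sB' b bb).
have sXF : X \subset fund_cocircuit setT B' b.
  apply: subset_trans (fund_cocircuit_sub bas bb bB' sB'); apply/subsetP=> x xX.
  by apply/fund_cocircuitP=> //; rewrite setDv inE setU0 loopless_indep1.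
have XF : X = fund_cocircuit setT B' b.
  apply/eqP; rewrite eqEcard sXF (leq_trans _ maxX) //.
  exact: cocircuit_le_max.
by apply: cocircuit_rank1_full; rewrite ?rX // XF.
Qed.

(** * Uniform matroids *)

Definition uniform_of_rank r := forall X, M X = (#|X| <= r).

(** The bases are the sets of [r] elements, so [X] avoids one exactly when its complement has at
    least [r] elements. *)
Lemma uniform_coindep r X : uniform_of_rank r -> r <= #|T| ->
  coindep M X = (#|X| <= #|T| - r).
Proof.
move=> uM le_r; have subset_of_card (A : {set T}) : r <= #|A| ->
    exists2 J : {set T}, J \subset A & #|J| = r.
  rewrite -bin_gt0 -cards_draws => /card_gt0P[J]; rewrite inE.
  by case/andP=> sJA /eqP; exists J.
have basisE B : basis M B = (#|B| == r).
  have [|J _ cJ] := subset_of_card setT; first by rewrite cardsT.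
  have rT : rank setT = r.
    apply/eqP; rewrite eqn_leq -{2}cJ leq_rank ?subsetT ?uM ?cJ // andbT.
    by apply/bigmax_leqP=> I /andP[]; rewrite uM.
  apply/basisP/eqP => [[_ _ ->] // | cB].
  by split; rewrite ?subsetT ?uM ?cB.
apply/existsP/idP => [[B /andP[]] | leX].
  by rewrite basisE => /eqP <- /subset_leq_card; rewrite [#|~: B|]cardsCs setCK.
have [|J sJ cJ] := subset_of_card (~: X).
  by rewrite [#|~: X|]cardsCs setCK leq_subRL ?max_card // addnC -leq_subRL.
by exists J; rewrite basisE cJ eqxx -disjoints_subset disjoint_sym disjoints_subset.
Qed.

Lemma uniform_max_cocircuit_size r : uniform_of_rank r -> 0 < r <= #|T| ->
  max_cocircuit_size M = (#|T| - r).+1.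
Proof.
move=> uM /andP[r_gt0 le_r].
have coE X : coindep M X = (#|X| <= #|T| - r) := uniform_coindep X uM le_r.
apply/eqP; rewrite eqn_leq; apply/andP; split.
  apply/bigmax_leqP=> C /minsetP[dC minC].
  have [-> | [x xC]] := set_0Vmem C; first by rewrite cards0.
  have : coindep M (C :\ x).
    apply: contraT => /minC/(_ (subsetDl _ _))/setP/(_ x).
    by rewrite !inE eqxx xC.
  by rewrite coE (cardsD1 x C) xC.
(* As [r > 0], a set one larger than the rank of the dual exists; it is a circuit there. *)
have : 0 < 'C(#|[set: T]|, (#|T| - r).+1).
  by rewrite bin_gt0 cardsT ltn_subrL r_gt0 (leq_trans r_gt0).
rewrite -cards_draws => /card_gt0P[C]; rewrite inE => /andP[_ /eqP cC].
rewrite -cC; apply: cocircuit_le_max; apply/minsetP; split.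
  by rewrite /= coE cC ltnn.
move=> Y; rewrite /= coE -ltnNge => ltY sY.
by apply/eqP; rewrite eqEcard sY cC.
Qed.

Lemma isomorphic_uniformP r n :
  isomorphic M (uniform r n) <-> #|T| = n /\ uniform_of_rank r.
Proof.
split=> [[f bij_f isoM] | [cT uM]].
  split=> [|X]; first by rewrite (bij_eq_card bij_f) card_ord.
  by rewrite -isoM /= /uniform_indep card_imset //; apply: bij_inj.
subst n; exists (@enum_rank T) => [|X]; first exact: enum_rank_bij.
by rewrite uM /= /uniform_indep card_imset //; apply: enum_rank_inj.
Qed.

Lemma arboricity_rank1 : loopless M -> uniform_of_rank 1 -> arboricity M = #|T|.
Proof.
move=> ll uM; apply/eqP; rewrite eqn_leq; apply/andP; split.
  apply: (@arboricity_le_cover _ (fun x => [set x])) => // x.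
    exact: loopless_indep1.
  by exists x; rewrite set11.
by rewrite -[arboricity M]muln1 card_le_arboricity // => X; rewrite uM.
Qed.

(** A point and its complement cover; a single independent set is too small. *)
Lemma arboricity_circuit k : loopless M -> 0 < k -> #|T| = k.+1 ->
  uniform_of_rank k -> arboricity M = 2.
Proof.
move=> ll k_gt0 cT uM; apply/eqP; rewrite eqn_leq; apply/andP; split.
  have [x _] : exists x, x \in T by apply/card_gt0P; rewrite cT.
  have := @arboricity_le_cover bool (fun i => if i then [set x] else [set~ x]) ll.
  rewrite card_bool; apply=> [[] | y].
  - exact: loopless_indep1.
  - by rewrite uM cardsC1 cT.
  by exists (y == x); case: eqVneq => yx; rewrite !inE ?yx.
have := @card_le_arboricity k ll; rewrite cT => /(_ _).
have le_k X : indep M X -> #|X| <= k by rewrite uM.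
by move/(_ le_k); case: (arboricity M) => [|[|//]]; rewrite ?mul1n ?ltnn.
Qed.

Lemma rank1_uniform : loopless M -> rank setT = 1 -> uniform_of_rank 1.
Proof.
move=> ll rT X; apply/idP/idP => [iX | ].
  by rewrite -rT leq_rank ?subsetT.
rewrite leq_eqVlt ltnS leqn0 => /orP[/cards1P[x ->] | ].
  exact: loopless_indep1.
by rewrite cards_eq0 => /eqP->; apply: indep_set0.
Qed.

Lemma circuit_setT_uniform : circuit M setT -> uniform_of_rank #|T|.-1.
Proof.
move=> /circuitP[dT iT] X; have [-> | nX] := eqVneq X setT.
  rewrite (negPf dT) cardsT; have [T0 | [x _]] := set_0Vmem [set: T].
    by rewrite T0 indep_set0 in dT.
  by rewrite leqNgt prednK ?leqnn //; apply/card_gt0P; exists x.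
have /subsetPn[x _ xNX] : ~~ (setT \subset X) by rewrite subTset.
rewrite (indep_sub _ (iT x (in_setT x))) ?subsetD1 ?subsetT //.
apply/esym; rewrite -ltnS prednK; last by apply/card_gt0P; exists x.
by rewrite -cardsT proper_card // properT.
Qed.

(** * The case of equality *)

Lemma uniform_of_arboricity_eq : 0 < #|T| -> connected_matroid M -> loopless M ->
    arboricity M = max_cocircuit_size M ->
  uniform_of_rank 1 \/ uniform_of_rank #|T|.-1 /\ 1 < #|T|.
Proof.
move=> T_gt0 conn ll eq_a.
have a_gt0 : 0 < arboricity M.
  have := @card_le_arboricity #|T| ll (fun X _ => max_card (mem X)).
  by case: (arboricity M) => //; rewrite leqNgt T_gt0.
have [k maxM] : exists k, max_cocircuit_size M = k.+1.
  by exists (arboricity M).-1; rewrite -eq_a prednK.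
have full X : rank X = 1 -> #|X| = k.+1 -> uniform_of_rank 1.
  move=> rX cX; apply: rank1_uniform => //.
  by rewrite -(rank1_max_full ll conn rX) // maxM cX.
have [k_gt1 | k_le1] := ltnP 1 k.
  have [|X ltX minX] := @minimal_dense_exists k ll; first by rewrite eq_a maxM.
  by have [rX cX] := minimal_dense_rank1 ll maxM k_gt1 ltX minX; left; apply: full cX.
(* For [k = 0] a singleton already has rank 1 and the maximum cocircuit size. The remaining case is
   [k = 1], where any circuit is the whole ground set. *)
have [k0 | k_gt0] := posnP k.
  have [x _] := card_gt0P T_gt0.
  left; apply: (full [set x]); rewrite ?cards1 ?k0 //.
  by apply/eqP; rewrite -(cards1 x) -rank_indepE loopless_indep1.
have T_gt1 : 1 < #|T|.
  have : max_cocircuit_size M <= #|T| by apply/bigmax_leqP=> C _; apply: max_card.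
  by rewrite maxM; apply: leq_trans.
right; split=> //; apply: circuit_setT_uniform.
have /card_gt1P[x [y [_ _ xy]]] := T_gt1.
have [D [cD _ _]] := conn x y xy.
by rewrite -(circuit_full conn _ cD) // maxM ltnS.
Qed.

End Rank.

Theorem theorem1p4 (T : finType) (M : matroid T)
    (hT : 0 < #|T|) (hconn : connected_matroid M) (hloop : loopless M) :
  arboricity M = max_cocircuit_size M <->
  exists2 k : nat, 1 <= k &
    isomorphic M (uniform k k.+1) \/ isomorphic M (uniform 1 k).
Proof.
split=> [/(uniform_of_arboricity_eq hT hconn hloop)[uM | [uM T_gt1]] | [k k_gt0]].
- by exists #|T| => //; right; apply/isomorphic_uniformP.
- exists #|T|.-1; first by rewrite -ltnS prednK.
  by left; apply/isomorphic_uniformP; rewrite prednK.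
case=> /isomorphic_uniformP[cT uM].
  (* Both sides are 2 for [uniform k k.+1]; for [uniform 1 k] both are [#|T|]. *)
  rewrite (arboricity_circuit hloop k_gt0 cT uM).
  by rewrite (uniform_max_cocircuit_size uM) cT ?k_gt0 ?leqnSn // subSnn.
rewrite (arboricity_rank1 hloop uM) (uniform_max_cocircuit_size uM) ?hT //.
by rewrite subn1 prednK.
Qed.
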